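(* Let $n$ be a positive integer and $r>0$. Let $\{\Omega_k\}_{k\in\mathbb{N}}$ be a family of uniformly bounded domains in $\mathbb{R}^n$ (all contained in one common bounded set) satisfying $\mathscr{L}^n(\Omega_k)=\mathscr{L}^n(\mathfrak{B}_r)$ for every $k$. If $$|\lambda_{1,\infty}^D(\Omega_k)-\lambda_{1,\infty}^D(\mathfrak{B}_r)|=o(1)\quad\text{and}\quad|\lambda_{1,\infty}^N(\Omega_k)-\lambda_{1,\infty}^N(\mathfrak{B}_r)|=o(1)\quad\text{as }k\to\infty,$$ then $\Omega_k\to\mathfrak{B}_r$ in the sense that the Hausdorff distance between $\Omega_k$ and a ball $\mathfrak{B}_r$ of radius $r$ goes to zero, i.e. there is a ball $\mathfrak{B}_r$ of radius $r$ with $$d_{\mathcal{H}}(\Omega_k,\mathfrak{B}_r):=\max\Big\{\sup_{x\in\Omega_k}\inf_{y\in\mathfrak{B}_r}|x-y|,\ \sup_{y\in\mathfrak{B}_r}\inf_{x\in\Omega_k}|x-y|\Big\}\to0\quad\text{as }k\to\infty.$$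
   Context: $\mathscr{L}^n$ is Lebesgue measure on $\mathbb{R}^n$; a domain is a connected open set; $\mathfrak{B}_\rho$ denotes an open Euclidean ball of radius $\rho$ in $\mathbb{R}^n$. For a bounded domain $\Omega$, the first Dirichlet $\infty$-eigenvalue is $$\lambda_{1,\infty}^D(\Omega)=\inf\{\|\nabla u\|_{L^\infty(\Omega)}: u\in W^{1,\infty}_0(\Omega),\ \|u\|_{L^\infty(\Omega)}=1\}=\Big(\max_{x\in\Omega}\mathrm{dist}(x,\partial\Omega)\Big)^{-1},$$ i.e. the reciprocal of the radius of the largest ball inscribed in $\Omega$ (this formula may be taken as the definition). The first nontrivial Neumann $\infty$-eigenvalue is $$\lambda_{1,\infty}^N(\Omega)=\frac{2}{\mathrm{diam}(\Omega)},$$ where $\mathrm{diam}(\Omega)=\max_{x,y\in\overline\Omega}d_\Omega(x,y)$ is the intrinsic diameter and $d_\Omega(x,y)$ is the geodesic distance, the infimum of the lengths of Lipschitz curves in $\overline\Omega$ connecting $x$ and $y$ (this formula is taken as the definition). In particular $\lambda_{1,\infty}^D(\mathfrak{B}_r)=\lambda_{1,\infty}^N(\mathfrak{B}_r)=1/r$.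
   Formalization: The ball of radius r may have a centre depending on k: one fixed ball is impossible, since Ω_k alternating between two translates of a radius-r ball meets every hypothesis but has no single limit ball. *)

(* Defs.v *)
From HB Require Import structures.
From mathcomp Require Import all_boot all_order all_algebra.
From mathcomp Require Import all_classical all_reals all_analysis.
Set Implicit Arguments.
Unset Strict Implicit.
Unset Printing Implicit Defensive.
Import Order.TTheory GRing.Theory Num.Theory.
Import numFieldNormedType.Exports.
Local Open Scope classical_set_scope.
Local Open Scope ring_scope.

(* The library norm on 'rV[R]_n is the sup norm: it induces the usual topology
   and the usual bounded sets, but metric notions must go through [enorm]. *)
Definition enorm (R : realType) (n : nat) (x : 'rV[R]_n) : R :=
  Num.sqrt (\sum_i x ord0 i ^+ 2).

Definition eball (R : realType) (n : nat) (c : 'rV[R]_n) (r : R)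
  : set 'rV[R]_n := [set x | enorm (x - c) < r].

Definition domain (R : realType) (n : nat) (A : set 'rV[R]_n) : Prop :=
  open A /\ connected A.

Definition boundary (R : realType) (n : nat) (A : set 'rV[R]_n)
  : set 'rV[R]_n := closure A `\` interior A.

(* [+oo] when [A] is empty. *)
Definition dist_set (R : realType) (n : nat) (x : 'rV[R]_n) (A : set 'rV[R]_n)
  : \bar R := ereal_inf [set (enorm (x - y))%:E | y in A].

Definition hausdorff_dist (R : realType) (n : nat) (A B : set 'rV[R]_n)
  : \bar R :=
  maxe (ereal_sup [set dist_set x B | x in A])
       (ereal_sup [set dist_set y A | y in B]).

Definition box (R : realType) (n : nat) (ab : 'rV[R]_n * 'rV[R]_n)
  : set 'rV[R]_n := [set x | forall i, ab.1 ord0 i <= x ord0 i <= ab.2 ord0 i].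

Definition box_volume (R : realType) (n : nat) (ab : 'rV[R]_n * 'rV[R]_n) : R :=
  \prod_i (ab.2 ord0 i - ab.1 ord0 i).

(* Lebesgue measure on R^n, as an outer measure: infimum of the total volume of
   the countable covers by closed boxes. *)
Definition leb (R : realType) (n : nat) (A : set 'rV[R]_n) : \bar R :=
  ereal_inf [set (\sum_(k <oo) (box_volume (F k))%:E)%E |
    F in [set F : nat -> 'rV[R]_n * 'rV[R]_n |
      (forall k i, (F k).1 ord0 i <= (F k).2 ord0 i) /\
      A `<=` \bigcup_k box (F k)]].

(* Curves are parametrized by [0, 1]; values outside [0, 1] are irrelevant. *)
Definition lipschitz_curve (R : realType) (n : nat) (A : set 'rV[R]_n)
    (x y : 'rV[R]_n) (g : R -> 'rV[R]_n) : Prop :=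
  [/\ exists L : R, forall s t, 0 <= s <= 1 -> 0 <= t <= 1 ->
        enorm (g s - g t) <= L * `|s - t|,
      forall t, 0 <= t <= 1 -> A (g t),
      g 0 = x & g 1 = y].

Definition curve_variation (R : realType) (n : nat) (g : R -> 'rV[R]_n)
    (s : seq R) : R :=
  let G := g \o nth 1 (0 :: s) in
  \sum_(0 <= i < size s) enorm (G i.+1 - G i).

Definition curve_length (R : realType) (n : nat) (g : R -> 'rV[R]_n) : \bar R :=
  ereal_sup [set (curve_variation g s)%:E | s in itv_partition 0 1].

(* [+oo] when no Lipschitz curve in the closure of [A] joins [x] and [y]. *)
Definition geodesic_dist (R : realType) (n : nat) (A : set 'rV[R]_n)
    (x y : 'rV[R]_n) : \bar R :=
  ereal_inf [set curve_length g | g in lipschitz_curve (closure A) x y].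

Definition intrinsic_diam (R : realType) (n : nat) (A : set 'rV[R]_n)
  : \bar R :=
  ereal_sup [set geodesic_dist A xy.1 xy.2 | xy in closure A `*` closure A].

Definition lambdaD (R : realType) (n : nat) (A : set 'rV[R]_n) : \bar R :=
  ((ereal_sup [set dist_set x (boundary A) | x in A])^-1)%E.

(* Infinite intrinsic diameter gives eigenvalue 0. *)
Definition lambdaN (R : realType) (n : nat) (A : set 'rV[R]_n) : \bar R :=
  (2%:E / intrinsic_diam A)%E.

(* Main.v *)
Require Import Defs.
From HB Require Import structures.
From mathcomp Require Import all_boot all_order all_algebra.
From mathcomp Require Import all_classical all_reals all_analysis.
From mathcomp Require Import ring lra.
Import Order.TTheory GRing.Theory Num.Theory.
Import numFieldNormedType.Exports.
Local Open Scope classical_set_scope.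
Local Open Scope ring_scope.

(** The two eigenvalues control two radii of a domain [A].  If [lambdaD A] is
close to [1 / r], then [A] contains a ball [eball c (r - d)] with [d] small,
because [1 / lambdaD A] is the largest distance from a point of [A] to the
boundary.  If [lambdaN A] is close to [1 / r], then the intrinsic diameter of
[A] is at most [2 * (r + d)], hence so is the Euclidean one, since no curve is
shorter than the distance between its endpoints.

These two facts already pin [A] down.  A point [y] of [A] at distance [N] from
[c] is at distance almost [N + (r - d)] from the point of [eball c (r - d)]
that lies opposite to it, so the diameter bound gives [N <= r + 3 * d]
([sub_eball_of_diam]).  So [A] contains [eball c (r - d)] and stays within
[r + 3 * d] of [c], and comparing [A] with [eball c r] through the homotheties
of center [c] bounds their Hausdorff distance by [4 * d] ([hausdorff_dist_le]).

It remains to know that both eigenvalues of the ball of radius [r] are [1 / r]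
([lambdaD_eball0], [lambdaN_eball0]), and to choose the centers: the center
above depends on [d], so [c k] is taken to be a minimizer, up to [1 / (k + 1)],
of the Hausdorff distance from [Omega k] to the balls of radius [r]. *)

(** * The Euclidean norm *)

Section EuclideanNorm.
Context {R : realType} {n : nat}.
Implicit Types (x y z : 'rV[R]_n) (t : R).

Lemma enorm_ge0 x : 0 <= enorm x.
Proof. exact: sqrtr_ge0. Qed.

Lemma sqr_enorm x : enorm x ^+ 2 = \sum_i x ord0 i ^+ 2.
Proof. by rewrite sqr_sqrtr// sumr_ge0// => i _; rewrite sqr_ge0. Qed.

Lemma enormZ t x : enorm (t *: x) = `|t| * enorm x.
Proof.
rewrite -sqrtr_sqr -sqrtrM ?sqr_ge0// /enorm mulr_sumr; congr Num.sqrt.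
by apply: eq_bigr => i _; rewrite mxE exprMn.
Qed.

Lemma enormN x : enorm (- x) = enorm x.
Proof. by rewrite -scaleN1r enormZ normrN1 mul1r. Qed.

Lemma enorm0 : enorm (0 : 'rV[R]_n) = 0.
Proof. by rewrite -(scale0r 0) enormZ normr0 mul0r. Qed.

Lemma enormBC x y : enorm (x - y) = enorm (y - x).
Proof. by rewrite -enormN opprB. Qed.

Lemma enorm_eq0 x : enorm x = 0 -> x = 0.
Proof.
move=> /(congr1 (fun a => a ^+ 2)); rewrite sqr_enorm expr0n/= => /eqP.
rewrite psumr_eq0 => [/allP x0|i _]; last exact: sqr_ge0.
apply/rowP => i; rewrite mxE; apply/eqP; rewrite -sqrf_eq0.
exact: (implyP (x0 i (mem_index_enum i))).
Qed.

(** The sum of squares of the entries of [|y|^2 x - <x, y> y] is nonnegative,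
and equals [|y|^2 (|x|^2 |y|^2 - <x, y>^2)]. *)
Lemma cauchy_schwarz x y :
  \sum_i x ord0 i * y ord0 i <= enorm x * enorm y.
Proof.
have [y0|y_gt0] := leP (enorm y) 0.
  have -> : y = 0 by apply: enorm_eq0; apply/eqP; rewrite eq_le y0 enorm_ge0.
  by rewrite enorm0 mulr0 big1// => i _; rewrite mxE mulr0.
set c := \sum_i _.
have B_gt0 : 0 < enorm y ^+ 2 by rewrite exprn_gt0.
apply: le_trans (ler_norm _) _.
rewrite -(@ler_pXn2r _ 2)// ?nnegrE ?mulr_ge0 ?enorm_ge0//.
rewrite real_normK ?num_real// exprMn.
have : 0 <= \sum_i (enorm y ^+ 2 * x ord0 i - c * y ord0 i) ^+ 2.
  by apply: sumr_ge0 => i _; exact: sqr_ge0.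
under eq_bigr => i _.
  rewrite (_ : _ ^+ 2 = enorm y ^+ 2 ^+ 2 * x ord0 i ^+ 2
    + (- 2 * enorm y ^+ 2 * c * (x ord0 i * y ord0 i)
    + c ^+ 2 * y ord0 i ^+ 2)); last by ring.
  over.
rewrite !big_split/= -!mulr_sumr -!sqr_enorm -/c.
rewrite (_ : _ + _ = enorm y ^+ 2 * (enorm x ^+ 2 * enorm y ^+ 2 - c ^+ 2)).
  by rewrite pmulr_rge0// subr_ge0.
ring.
Qed.

Lemma enormD x y : enorm (x + y) <= enorm x + enorm y.
Proof.
rewrite -(@ler_pXn2r _ 2)// ?nnegrE ?addr_ge0 ?enorm_ge0//.
rewrite sqr_enorm sqrrD !sqr_enorm.
under eq_bigr do rewrite mxE sqrrD.
rewrite !big_split/= lerD2r lerD2l.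
by rewrite mulr2n lerD ?cauchy_schwarz.
Qed.

Lemma enorm_continuous : continuous (@enorm R n).
Proof.
move=> x; apply: (@continuous_comp _ _ _
  (fun y => \sum_i y ord0 i ^+ 2) Num.sqrt); last exact: sqrt_continuous.
move: x; apply: continuous_big => [|i _ x]; first exact: add_continuous.
apply: (@continuous_comp _ _ _ (fun y => y ord0 i) (fun t : R => t ^+ 2)).
  exact: coord_continuous.
exact: exprn_continuous.
Qed.

End EuclideanNorm.

(** * Balls, segments and the boundary *)

Section Balls.
Context {R : realType} {n : nat}.
Implicit Types (x y c : 'rV[R]_n) (A : set 'rV[R]_n) (r : R).

Lemma open_eball c r : open (eball c r).
Proof.
have -> : eball c r = (fun x => enorm (x - c)) @^-1` [set t | t < r] by [].
apply: open_comp; last exact: open_lt.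
move=> x _; apply: (@continuous_comp _ _ _ (fun y => y - c) (@enorm R n)).
  by apply: continuousB; [exact: cvg_id|exact: cst_continuous].
exact: enorm_continuous.
Qed.

(** A point of the closed ball is the limit of its own multiples [t *: x] as [t]
tends to 1 from below, and these lie in the open ball. *)
Lemma closure_eball0 r : 0 < r ->
  closure (eball 0 r) = [set x : 'rV[R]_n | enorm x <= r].
Proof.
move=> r_gt0; apply/seteqP; split=> x /=.
  have clr : closed [set x : 'rV[R]_n | enorm x <= r].
    apply: (@preimage_closed _ _ (@enorm R n) [set t | t <= r]).
      by move=> y _; exact: enorm_continuous.
    exact: closed_le.
  rewrite [X in _ -> X](_ : _ = [set x : 'rV[R]_n | enorm x <= r] x)//.
  rewrite [X in _ -> X _](closure_id _).1//; apply: closure_subset => y.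
  by rewrite /eball/= subr0 => /ltW.
move=> xr B Bx.
have Bt : \forall t \near (1:R)^'-, B (t *: x).
  have : (t *: x) @[t --> (1:R)^'-] --> 1 *: x.
    by apply: cvg_at_left_filter; exact: scalel_continuous.
  by rewrite scale1r; apply.
have [t [t_gt0 t_lt1 ?]] : exists t : R, [/\ 0 < t, t < 1 & B (t *: x)].
  apply: (@filter_ex _ (1:R)^'-); near=> t; split; near: t => //.
    exact: nbhs_left_gt.
  exact: nbhs_left_lt.
exists (t *: x); split=> //.
rewrite /eball/= subr0 enormZ gtr0_norm//.
apply: le_lt_trans (_ : t * r < r); first by rewrite ler_pM2l.
by rewrite gtr_pMl.
Unshelve. all: by end_near. Qed.

Lemma boundary_eball0 r : 0 < r ->
  boundary (eball 0 r) = [set x : 'rV[R]_n | enorm x = r].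
Proof.
move=> r_gt0; rewrite /boundary closure_eball0//.
rewrite (interior_id _).1; last exact: open_eball.
apply/seteqP; split=> x /=.
  move=> [xr]; rewrite /eball/= subr0 => /negP.
  by rewrite -leNgt => rx; apply/le_anti/andP.
by move=> xr; split; [rewrite xr | rewrite /eball/= subr0 xr ltxx].
Qed.

Lemma unit_vector : (0 < n)%N -> exists e : 'rV[R]_n, enorm e = 1.
Proof.
move=> n_gt0; exists (delta_mx ord0 (Ordinal n_gt0)).
rewrite /enorm (bigD1 (Ordinal n_gt0))//= mxE !eqxx expr1n.
rewrite big1 ?addr0 ?sqrtr1//.
by move=> i /negPf ni; rewrite mxE eqxx/= ni expr0n.
Qed.

(** The nearest point of the sphere lies on the ray through [x]; at the center
every direction will do. *)
Lemma sphere_point x r : (0 < n)%N -> 0 <= r -> enorm x <= r ->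
  exists2 y, enorm y = r & enorm (x - y) = r - enorm x.
Proof.
move=> n_gt0 r_ge0 xr; have [x0|x0] := eqVneq (enorm x) 0.
  have [e e1] := unit_vector n_gt0; exists (r *: e).
    by rewrite enormZ e1 mulr1 ger0_norm.
  rewrite (enorm_eq0 _ x0) sub0r enormN enormZ e1 enorm0.
  by rewrite mulr1 subr0 ger0_norm.
have x_gt0 : 0 < enorm x by rewrite lt_def x0 enorm_ge0.
exists ((r / enorm x) *: x).
  by rewrite enormZ ger0_norm ?divr_ge0 ?enorm_ge0// divfK.
rewrite -[X in X - _]scale1r -scalerBl enormZ ler0_norm.
  by rewrite opprB mulrBl mul1r divfK.
by rewrite subr_le0 ler_pdivlMr// mul1r.
Qed.

Lemma dist_set_le x y A : A y -> (dist_set x A <= (enorm (x - y))%:E)%E.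
Proof. by move=> Ay; apply: ereal_inf_lbound; exists y. Qed.

Lemma inradius_eball0 r : (0 < n)%N -> 0 < r ->
  ereal_sup [set dist_set x (boundary (eball (0 : 'rV[R]_n) r))
            | x in eball 0 r] = r%:E.
Proof.
move=> n_gt0 r_gt0; rewrite boundary_eball0//; apply/eqP; rewrite eq_le.
apply/andP; split.
  apply: ge_ereal_sup => _ [x + <-]; rewrite /eball/= subr0 => xr.
  have [y yr xy] := sphere_point x r n_gt0 (ltW r_gt0) (ltW xr).
  apply: le_trans (dist_set_le _ _ _ yr) _.
  by rewrite lee_fin xy gerBl enorm_ge0.
apply: le_trans (ereal_sup_ubound _); last first.
  by exists 0 => //; rewrite /eball/= subr0 enorm0.
apply: le_ereal_inf_tmp => _ [y /= <- <-].
by rewrite sub0r enormN.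
Qed.

Definition segment_path x y (t : R) := x + t *: (y - x).

Lemma segment_path_continuous x y : continuous (segment_path x y).
Proof.
suff : continuous ((cst x : R -> 'rV[R]_n) + (fun t : R => t *: (y - x))) by [].
move=> t; apply: continuousD; first exact: cst_continuous.
exact: scalel_continuous.
Qed.

Lemma enorm_segment_pathB x y s t :
  enorm (segment_path x y s - segment_path x y t) = `|s - t| * enorm (y - x).
Proof. by rewrite /segment_path opprD addrACA subrr add0r -scalerBl enormZ. Qed.

(** The segment from the center to a point of the ball is connected and meets
[A].  It avoids the boundary of [A], being too short to reach it, so [A] cuts
out of it a subset which is both relatively open and relatively closed. *)
Lemma eball_sub A x r : open A -> A x ->
  (r%:E <= dist_set x (boundary A))%E -> eball x r `<=` A.
Proof.
move=> oA Ax rA y yr.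
set S := [set segment_path x y t | t in `[(0:R), 1]].
have Sx : S x.
  by exists 0; rewrite ?/segment_path ?scale0r ?addr0//= in_itv/= lexx ler01.
have Sy : S y.
  by exists 1; rewrite ?/segment_path ?scale1r ?subrKC//= in_itv/= lexx ler01.
have cS : connected S.
  apply: connected_continuous_connected; first exact: segment_connected.
  exact/continuous_subspaceT/segment_path_continuous.
suff SA : S `&` A = S by have : (S `&` A) y; [rewrite SA | case].
apply: cS; first by exists x.
  by exists A.
exists (closure A); first exact: closed_closure.
apply/seteqP; split=> [z [Sz Az]|z [Sz Az]]; split=> //.
  exact: subset_closure.
apply: contrapT => nAz.
have : (r%:E <= (enorm (x - z))%:E)%E.
  apply: le_trans rA _; apply: dist_set_le.
  by split=> //; rewrite (interior_id _).1.
rewrite lee_fin leNgt => /negP; apply.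
case: Sz => t /=; rewrite in_itv/= => /andP[t0 t1] <-.
rewrite /segment_path opprD addrA subrr sub0r enormN enormZ ger0_norm//.
by apply: le_lt_trans yr; rewrite ler_piMl// enorm_ge0.
Qed.

(** The one-piece partition of [0, 1] bounds the length of a curve from below by
the distance between its endpoints. *)
Lemma enorm_le_geodesic_dist A x y :
  ((enorm (x - y))%:E <= geodesic_dist A x y)%E.
Proof.
apply: le_ereal_inf_tmp => _ [g [_ _ g0 g1] <-].
apply: ereal_sup_ubound; exists [:: 1].
  exact/itv_partition1/ltr01.
by rewrite /curve_variation/= big_nat1/= g0 g1 enormBC.
Qed.

Lemma curve_length_segment x y :
  (curve_length (segment_path x y) <= (enorm (x - y))%:E)%E.
Proof.
apply: ge_ereal_sup => _ [s sP <-]; rewrite lee_fin /curve_variation.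
have /(pathP 1) s_lt := sP.1.
rewrite (eq_big_nat _ _ (F2 := fun i =>
    (nth 1 (0 :: s) i.+1 - nth 1 (0 :: s) i) * enorm (x - y))); last first.
  move=> i /andP[_ /s_lt i_lt].
  by rewrite /= enorm_segment_pathB ger0_norm ?subr_ge0 ?ltW//= enormBC.
rewrite -mulr_suml telescope_sumr// (itv_partition_nth_size 1 sP).
by rewrite subr0 mul1r.
Qed.

End Balls.

(** * The eigenvalues of balls, and what they say about a set *)

Section Eigenvalues.
Context {R : realType} {n : nat}.
Implicit Types (x y c : 'rV[R]_n) (A B : set 'rV[R]_n) (r d : R).

(** The closed ball is convex, so the straight segment is an admissible
curve. *)
Lemma geodesic_dist_eball0 r x y : 0 < r -> enorm x <= r -> enorm y <= r ->
  (geodesic_dist (eball 0 r) x y <= (enorm (x - y))%:E)%E.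
Proof.
move=> r_gt0 xr yr; apply: le_trans (curve_length_segment x y).
apply: ereal_inf_lbound; exists (segment_path x y) => //; split.
- by exists (enorm (y - x)) => s t _ _; rewrite enorm_segment_pathB mulrC.
- move=> t /andP[t_ge0 t_le1]; rewrite closure_eball0//=.
  rewrite (_ : segment_path x y t = (1 - t) *: x + t *: y); last first.
    by rewrite /segment_path scalerBr scalerBl scale1r addrAC addrA.
  apply: le_trans (enormD _ _) _; rewrite !enormZ !ger0_norm ?subr_ge0//.
  by nra.
- by rewrite /segment_path scale0r addr0.
- by rewrite /segment_path scale1r subrKC.
Qed.

(** The bound [2 * r] is reached at antipodal points of the sphere. *)
Lemma intrinsic_diam_eball0 r : (0 < n)%N -> 0 < r ->
  intrinsic_diam (eball (0 : 'rV[R]_n) r) = (2 * r)%:E.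
Proof.
move=> n_gt0 r_gt0; apply/eqP; rewrite eq_le; apply/andP; split.
  apply: ge_ereal_sup => _ [[x y] [/= + +] <-].
  rewrite closure_eball0//= => xr yr.
  apply: le_trans (geodesic_dist_eball0 _ _ _ r_gt0 xr yr) _; rewrite lee_fin.
  by apply: le_trans (enormD _ _) _; rewrite enormN mulr_natl mulr2n lerD.
have [e e1] := unit_vector (R := R) n_gt0.
apply: le_trans (ereal_sup_ubound _); last first.
  exists (r *: e, - (r *: e)) => //; split=> /=; rewrite closure_eball0//=.
    by rewrite enormZ e1 mulr1 gtr0_norm.
  by rewrite enormN enormZ e1 mulr1 gtr0_norm.
apply: le_trans (enorm_le_geodesic_dist _ _ _).
rewrite lee_fin/= opprK -scalerDl enormZ e1 mulr1.
by rewrite gtr0_norm ?addr_gt0// mulr_natl mulr2n.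
Qed.

Lemma lambdaD_eball0 r : (0 < n)%N -> 0 < r ->
  lambdaD (eball (0 : 'rV[R]_n) r) = (r^-1)%:E.
Proof.
by move=> n_gt0 r_gt0; rewrite /lambdaD inradius_eball0// inver gt_eqF.
Qed.

Lemma lambdaN_eball0 r : (0 < n)%N -> 0 < r ->
  lambdaN (eball (0 : 'rV[R]_n) r) = (r^-1)%:E.
Proof.
move=> n_gt0 r_gt0; rewrite /lambdaN intrinsic_diam_eball0// inver.
by rewrite gt_eqF ?mulr_gt0// -EFinM invfM mulVKf// pnatr_eq0.
Qed.

Lemma eball_sub_of_lambdaD A l d : open A -> 0 < l -> lambdaD A = l%:E ->
  d < l^-1 -> exists c, eball c d `<=` A.
Proof.
move=> oA l_gt0 /(congr1 inve); rewrite inveK inver gt_eqF// => supA dl.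
have [_ [c Ac <-] /ltW dc] : exists2 t : \bar R,
    [set dist_set x (boundary A) | x in A] t & (d%:E < t)%E.
  by apply: ereal_sup_gt; rewrite supA lte_fin.
by exists c; exact: eball_sub.
Qed.

(** A finite positive eigenvalue rules out infinite and zero diameters, for
which [2 / diam] takes the conventional values [0] and [+oo]. *)
Lemma enorm_le_of_lambdaN A l x y : 0 < l -> lambdaN A = l%:E ->
  A x -> A y -> enorm (x - y) <= 2 * l^-1.
Proof.
move=> l_gt0 Al Ax Ay.
have : ((enorm (x - y))%:E <= intrinsic_diam A)%E.
  apply: le_trans (enorm_le_geodesic_dist A x y) _.
  by apply: ereal_sup_ubound; exists (x, y) => //; split; exact: subset_closure.
move: Al; rewrite /lambdaN; case: (intrinsic_diam A) => [t| |].
- rewrite inver; case: eqVneq => [_|t0].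
    by rewrite gt0_muley ?lte_fin.
  by rewrite -EFinM => -[<-]; rewrite lee_fin invfM invrK mulVKf// pnatr_eq0.
- by rewrite invey mule0 => -[/esym/eqP]; rewrite gt_eqF.
- by rewrite leeNy_eq.
Qed.

Lemma hausdorff_dist_ge0 A B : A !=set0 -> (0 <= hausdorff_dist A B)%E.
Proof.
move=> [x Ax]; rewrite /hausdorff_dist le_max; apply/orP; left.
apply: le_trans (ereal_sup_ubound _); last by exists x.
by apply: le_ereal_inf_tmp => _ [y _ <-]; rewrite lee_fin enorm_ge0.
Qed.

(** If [y] were too far from [c], some point of the inner ball opposite to [y]
would be at distance more than [2 * (r + d)] from [y]. *)
Lemma sub_eball_of_diam A c r d : 0 < d < r -> eball c (r - d) `<=` A ->
  (forall x y, A x -> A y -> enorm (x - y) <= 2 * (r + d)) ->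
  forall y, A y -> enorm (y - c) <= r + 3 * d.
Proof.
move=> /andP[d_gt0 dr] cA diamA y Ay; rewrite leNgt; apply/negP => yc.
set N := enorm (y - c) in yc.
pose s := 2 * (r + d) - N.
have N_gt0 : 0 < N by lra.
(* The witness against the diameter bound lies beyond c, seen from y, at a
   distance a from c: more than s to be too far from y, less than r - d to
   stay in the inner ball. *)
pose a := Num.max 0 ((r - d + s) / 2).
have a_ge0 : 0 <= a by rewrite le_max lexx.
have a_lt : a < r - d by rewrite gt_max; apply/andP; split; rewrite /s; lra.
have a_gt : s < a by rewrite lt_max; apply/orP; right; rewrite /s; lra.
pose z := c - (a / N) *: (y - c).
have : A z.
  apply: cA; rewrite /eball/= /z addrC addKr enormN enormZ -/N.
  by rewrite ger0_norm ?divr_ge0 ?(ltW N_gt0)// divfK ?gt_eqF.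
move=> /(diamA _ _ Ay); apply/negP; rewrite -ltNge.
rewrite /z opprB addrCA -[X in enorm (_ + X)]scale1r -scalerDl enormZ -/N.
rewrite ger0_norm ?addr_ge0 ?divr_ge0 ?(ltW N_gt0)//.
by rewrite [ltRHS]mulrDl mul1r divfK ?gt_eqF//; move: a_gt; rewrite /s; lra.
Qed.

(** A point of [A] is moved into [eball c r] by the homothety of center [c] and
ratio [r / (r + 4 * d)], strictly smaller than [r / (r + 3 * d)] because the
ball is open; a point of [eball c r] is moved into [A] by the ratio
[(r - d) / r].  These move points by at most [4 * d] and [d] respectively. *)
Lemma hausdorff_dist_le A c r d : 0 < d < r -> eball c (r - d) `<=` A ->
  (forall x, A x -> enorm (x - c) <= r + 3 * d) ->
  (hausdorff_dist A (eball c r) <= (4 * d)%:E)%E.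
Proof.
move=> /andP[d_gt0 dr] cA Ac; rewrite /hausdorff_dist ge_max.
have homothety t x : 0 <= t -> t <= 1 ->
    enorm (segment_path c x t - c) = t * enorm (x - c) /\
    enorm (x - segment_path c x t) = (1 - t) * enorm (x - c).
  move=> t_ge0 t_le1; split.
    by rewrite /segment_path addrC addKr enormZ ger0_norm.
  rewrite /segment_path opprD addrA -[X in X - _]scale1r -scalerBl enormZ.
  by rewrite ger0_norm ?subr_ge0.
have rd_gt0 : 0 < r + 4 * d by lra.
apply/andP; split; apply: ge_ereal_sup => _ [x Ax <-].
  pose t := r / (r + 4 * d).
  have tE : t * (r + 4 * d) = r by rewrite divfK ?gt_eqF.
  have t_gt0 : 0 < t by rewrite divr_gt0//; lra.
  have t_le1 : t <= 1 by rewrite ler_pdivrMr//; lra.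
  have [xt xt'] := homothety t x (ltW t_gt0) t_le1.
  have := Ac _ Ax; have := enorm_ge0 (x - c) => x0 xr.
  apply: le_trans (dist_set_le _ _ _ (_ : eball c r (segment_path c x t))) _.
    by rewrite /eball/= xt; nra.
  by rewrite lee_fin xt'; nra.
pose t := (r - d) / r.
have tE : t * r = r - d by rewrite divfK ?gt_eqF//; lra.
have t_gt0 : 0 < t by rewrite divr_gt0//; lra.
have t_le1 : t <= 1 by rewrite ler_pdivrMr//; lra.
have [xt xt'] := homothety t x (ltW t_gt0) t_le1.
have x0 := enorm_ge0 (x - c); rewrite /eball/= in Ax.
apply: le_trans (dist_set_le _ _ _ (_ : A (segment_path c x t))) _.
  by apply: cA; rewrite /eball/= xt -tE ltr_pM2l.
by rewrite lee_fin xt'; nra.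
Qed.

End Eigenvalues.

(** * Limits in the extended reals *)

(** The form in which the convergence of the eigenvalues is used: they are
eventually finite and positive, and their inverses, which are the geometric
quantities, approach [r]. *)
Lemma cvg_inv_approx (R : realType) (u : nat -> \bar R) (r d : R) :
  0 < r -> 0 < d -> (`|u k - (r^-1)%:E|)%E @[k --> \oo] --> 0%E ->
  \forall k \near \oo,
    exists l, [/\ u k = l%:E, 0 < l & r - d < l^-1 < r + d].
Proof.
move=> r_gt0 d_gt0 /cvg_abse0P u0.
have /fine_cvgP[u_fin u_cvg] : u k @[k --> \oo] --> (r^-1)%:E.
  exact/sube_cvg0.
have ri : r^-1 != 0 by rewrite invr_eq0 gt_eqF.
have uV_cvg := cvgV ri u_cvg; rewrite invrK in uV_cvg.
near=> k; exists (fine (u k)); split.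
- by rewrite fineK//; near: k.
- by near: k; apply: (cvgr_gt _ u_cvg); rewrite invr_gt0.
- rewrite -ltr_distlC; near: k.
  exact: (cvgr_dist_lt _ _ (uV_cvg _)).
Unshelve. all: by end_near. Qed.

(** When the infimum is [+oo], the function is constantly [+oo] and every point
is a minimizer. *)
Lemma near_minimizer (R : realType) (T : pointedType) (h : T -> \bar R)
    (d : R) : 0 < d -> (forall c, 0 <= h c)%E ->
  exists c, forall c', (h c <= h c' + d%:E)%E.
Proof.
move=> d_gt0 h_ge0; set m := ereal_inf (range h).
have mh c : (m <= h c)%E by apply: ereal_inf_lbound; exists c.
have m_ge0 : (0 <= m)%E by apply: le_ereal_inf_tmp => _ [c _ <-].
have [m_fin|] := boolP (m \is a fin_num).
  have [_ [c _ <-] hc] := lb_ereal_inf_adherent d_gt0 m_fin.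
  by exists c => c'; apply: le_trans (ltW hc) _; rewrite leeD2r.
rewrite ge0_fin_numE// -leNgt leye_eq => /eqP my.
exists point => c'; have := mh c'; rewrite my leye_eq => /eqP ->.
by rewrite addye// leey.
Qed.

Lemma cvge0_near_le (R : realType) (u : nat -> \bar R) :
  (forall e : R, 0 < e -> \forall k \near \oo, (0 <= u k <= e%:E)%E) ->
  u k @[k --> \oo] --> 0%E.
Proof.
move=> ule; apply/fine_cvgP; split.
  apply: filterS (ule 1 ltr01) => k /andP[u_ge0 u_le].
  by rewrite ge0_fin_numE// (le_lt_trans u_le) ?ltry.
apply/cvgrPdist_le => e /ule; apply: filterS => k /andP[u_ge0 u_le].
have u_fin : u k \is a fin_num.
  by rewrite ge0_fin_numE// (le_lt_trans u_le) ?ltry.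
by rewrite sub0r normrN ger0_norm ?fine_ge0// -lee_fin fineK.
Qed.

(** * Stability of the ball *)

Theorem theorem1p2 (R : realType) (n : nat) (n_gt0 : (0 < n)%N)
    (r : R) (r_gt0 : 0 < r) (Omega : nat -> set 'rV[R]_n)
    (Omega_domain : forall k, domain (Omega k))
    (Omega_bounded : exists2 B : set 'rV[R]_n,
      bounded_set B & forall k, Omega k `<=` B)
    (Omega_volume : forall k, leb (Omega k) = leb (eball (0 : 'rV[R]_n) r))
    (lambdaD_cvg :
      (`|lambdaD (Omega k) - lambdaD (eball (0 : 'rV[R]_n) r)|)%E
        @[k --> \oo] --> 0%E)
    (lambdaN_cvg :
      (`|lambdaN (Omega k) - lambdaN (eball (0 : 'rV[R]_n) r)|)%E
        @[k --> \oo] --> 0%E) :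
  exists c : nat -> 'rV[R]_n,
    hausdorff_dist (Omega k) (eball (c k) r) @[k --> \oo] --> 0%E.
Proof.
rewrite lambdaD_eball0// in lambdaD_cvg.
rewrite lambdaN_eball0// in lambdaN_cvg.
have approx (d : R) : 0 < d -> d < r -> \forall k \near \oo,
    Omega k !=set0 /\
    exists c, (hausdorff_dist (Omega k) (eball c r) <= (4 * d)%:E)%E.
  move=> d_gt0 dr.
  have D := cvg_inv_approx _ _ _ _ r_gt0 d_gt0 lambdaD_cvg.
  have N := cvg_inv_approx _ _ _ _ r_gt0 d_gt0 lambdaN_cvg.
  apply: filterS2 D N.
  move=> k [l [Dl l_gt0 /andP[dl _]]] [m [Nm m_gt0 /andP[_ dm]]].
  have [c cO] := eball_sub_of_lambdaD _ _ _ (Omega_domain k).1 l_gt0 Dl dl.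
  split.
    by exists c; apply: cO; rewrite /eball/= subrr enorm0 subr_gt0.
  have dr' : 0 < d < r by rewrite d_gt0.
  exists c; apply: hausdorff_dist_le => //.
  apply: sub_eball_of_diam => // x y Ox Oy.
  apply: le_trans (enorm_le_of_lambdaN _ _ _ _ m_gt0 Nm Ox Oy) _.
  by rewrite ler_pM2l// ltW.
have near_min k : exists c, Omega k !=set0 -> forall c',
    (hausdorff_dist (Omega k) (eball c r) <=
      hausdorff_dist (Omega k) (eball c' r) + k.+1%:R^-1%:E)%E.
  have [ne|ne] := pselect (Omega k !=set0); last by exists 0.
  have [| |c c_min] := @near_minimizer _ _
      (fun c => hausdorff_dist (Omega k) (eball c r)) k.+1%:R^-1.
  - by rewrite invr_gt0.
  - by move=> c; exact: hausdorff_dist_ge0.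
  - by exists c.
have [c c_min] := choice near_min.
exists c; apply: cvge0_near_le => e e_gt0.
(* The total error is 4 d + 1 / (k + 1), and each half is made at most e / 2. *)
pose d := Num.min (r / 2) (e / 8).
have d_gt0 : 0 < d by rewrite lt_min !divr_gt0.
have dr : d < r by rewrite gt_min; apply/orP; left; lra.
have de : d <= e / 8 by rewrite ge_min lexx orbT.
have e2 : 0 < e / 2 by rewrite divr_gt0.
apply: filterS2 (approx _ d_gt0 dr) (near_infty_natSinv_lt (PosNum e2)).
move=> k [ne [c' hc']] /= ke; rewrite hausdorff_dist_ge0//=.
apply: le_trans (c_min k ne c') _; apply: le_trans (leeD2r _ hc') _.
have {}ke : k.+1%:R^-1 < e / 2 := ke.
rewrite -EFinD lee_fin; move: (_^-1) ke => t ke; lra.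
Qed.
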